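(* There is a first-order characterization of those pairs that extend to a model structure among pairs with countably many weak equivalence classes. That is, there exists a set $T$ of first-order sentences in the language of categories with a designated subcategory such that for every finitely bicomplete poset $\mathcal{C}$ and every subcategory $\mathcal{W}$ of $\mathcal{C}$ having only countably many connected components, the structure $(\mathcal{C},\mathcal{W})$ satisfies all sentences of $T$ if and only if there exists a model structure on $\mathcal{C}$ whose class of weak equivalences is $\mathcal{W}$.
   Context: A poset is regarded as a skeletal category (isomorphic objects are equal) with at most one morphism between any two objects. It is finitely bicomplete if it has all finite limits and colimits. The language of categories with a designated subcategory is the first-order language whose variables range over the objects and morphisms of a category, with symbols for source, target, identities and composition, together with predicates singling out the objects and morphisms of the designated subcategory $\mathcal{W}$. Connected components of $\mathcal{W}$ are the classes of objects connected by zigzags of morphisms of $\mathcal{W}$. Lifting: for morphisms $f:A\to B$ and $g:X\to Y$, $f$ lifts on the left of $g$ if every commutative square from $f$ to $g$ (with top $A\to X$ and bottom $B\to Y$) admits a morphism $h:B\to X$ making the diagram commute. For a class $S$ of morphisms, $\mathrm{RLP}(S)$ is the class of morphisms $g$ such that every $f\in S$ lifts on the left of $g$, and $\mathrm{LLP}(S)$ is the class of morphisms $f$ that lift on the left of every $g\in S$. A weak factorization system (WFS) is a pair $(\mathcal{L},\mathcal{R})$ of classes of morphisms with $\mathcal{L}=\mathrm{LLP}(\mathcal{R})$, $\mathcal{R}=\mathrm{RLP}(\mathcal{L})$, such that every morphism factors as a morphism in $\mathcal{L}$ followed by a morphism in $\mathcal{R}$. A model structure on a finitely bicomplete category $\mathcal{C}$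 consists of three subcategories $\mathbb{C}_{we}$ (weak equivalences), $\mathbb{C}_{cof}$ (cofibrations), $\mathbb{C}_{fib}$ (fibrations) such that $(\mathbb{C}_{cof},\mathbb{C}_{fib}\cap\mathbb{C}_{we})$ and $(\mathbb{C}_{cof}\cap\mathbb{C}_{we},\mathbb{C}_{fib})$ are WFSs, and such that whenever two of $f$, $g$, $gf$ are in $\mathbb{C}_{we}$, so is the third. *)

(* Defs.v *)
From Stdlib Require Import Relation_Operators.
From mathcomp Require Import all_boot.
From mathcomp Require Import boolp classical_sets functions cardinality.

Set Implicit Arguments.
Unset Strict Implicit.
Unset Printing Implicit Defensive.

Local Open Scope classical_set_scope.
Local Open Scope card_scope.

Record category := Category {
  ob :> Type;
  hom : ob -> ob -> Type;
  idc : forall a, hom a a;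
  comp : forall a b c, hom b c -> hom a b -> hom a c;
  comp_idl : forall a b (f : hom a b), comp (idc b) f = f;
  comp_idr : forall a b (f : hom a b), comp f (idc a) = f;
  compA : forall a b c d (h : hom c d) (g : hom b c) (f : hom a b),
    comp h (comp g f) = comp (comp h g) f }.

Arguments hom {C} a b : rename.
Arguments idc {C} a : rename.
Arguments comp {C a b c} g f : rename.

Definition isomorphic (C : category) (a b : C) : Prop :=
  exists (f : hom a b) (g : hom b a), comp g f = idc a /\ comp f g = idc b.

Definition is_poset (C : category) : Prop :=
  (forall (a b : C) (f g : hom a b), f = g) /\
  (forall a b : C, isomorphic a b -> a = b).

Record functor (J C : category) := Functor {
  fob :> J -> C;
  fmor : forall i j, hom i j -> hom (fob i) (fob j);
  fmor_id : forall i, fmor (idc i) = idc (fob i);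
  fmor_comp : forall i j k (v : hom j k) (u : hom i j),
    fmor (comp v u) = comp (fmor v) (fmor u) }.

Arguments fmor {J C} f {i j} u : rename.

Definition is_cone (J C : category) (F : functor J C) (a : C)
    (p : forall i, hom a (F i)) : Prop :=
  forall (i j : J) (u : hom i j), comp (fmor F u) (p i) = p j.

Definition is_cocone (J C : category) (F : functor J C) (a : C)
    (p : forall i, hom (F i) a) : Prop :=
  forall (i j : J) (u : hom i j), comp (p j) (fmor F u) = p i.

Definition is_limit (J C : category) (F : functor J C) (a : C)
    (p : forall i, hom a (F i)) : Prop :=
  is_cone p /\
  forall (b : C) (q : forall i, hom b (F i)), is_cone q ->
    exists! h : hom b a, forall i, comp (p i) h = q i.

Definition is_colimit (J C : category) (F : functor J C) (a : C)
    (p : forall i, hom (F i) a) : Prop :=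
  is_cocone p /\
  forall (b : C) (q : forall i, hom (F i) b), is_cocone q ->
    exists! h : hom a b, forall i, comp h (p i) = q i.

Definition finite_category (J : category) : Prop :=
  finite_set [set: J] /\ forall i j : J, finite_set [set: hom i j].

Definition finitely_bicomplete (C : category) : Prop :=
  forall J : category, finite_category J -> forall F : functor J C,
    (exists (a : C) (p : forall i, hom a (F i)), is_limit p) /\
    (exists (a : C) (p : forall i, hom (F i) a), is_colimit p).

Definition morclass (C : category) := forall a b : C, set (hom a b).

Definition morclassI (C : category) (S T : morclass C) : morclass C :=
  fun a b => S a b `&` T a b.

(* Not assumed to contain all the objects. *)
Record subcategory (C : category) := Subcategory {
  sob : set C;
  smor :> morclass C;
  smor_src : forall (a b : C) (f : hom a b), smor f -> sob a;
  smor_tgt : forall (a b : C) (f : hom a b), smor f -> sob b;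
  smor_id : forall a : C, sob a -> smor (idc a);
  smor_comp : forall (a b c : C) (g : hom b c) (f : hom a b),
    smor g -> smor f -> smor (comp g f) }.

Arguments smor {C} W {a b} : rename.

Definition zigzag (C : category) (W : subcategory C) (a b : C) : Prop :=
  clos_refl_sym_trans C (fun x y => exists f : hom x y, smor W f) a b.

Definition components (C : category) (W : subcategory C) : set (set C) :=
  [set [set y | zigzag W x y] | x in sob W].

Definition lifts (C : category) (a b x y : C) (f : hom a b) (g : hom x y)
    : Prop :=
  forall (u : hom a x) (v : hom b y), comp g u = comp v f ->
    exists h : hom b x, comp h f = u /\ comp g h = v.

Definition RLP (C : category) (S : morclass C) : morclass C :=
  fun x y => [set g : hom x y |
    forall (a b : C) (f : hom a b), S a b f -> lifts f g].

Definition LLP (C : category) (S : morclass C) : morclass C :=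
  fun a b => [set f : hom a b |
    forall (x y : C) (g : hom x y), S x y g -> lifts f g].

Definition is_wfs (C : category) (L R : morclass C) : Prop :=
  [/\ L = LLP R, R = RLP L &
      forall (a b : C) (f : hom a b), exists (c : C) (l : hom a c) (r : hom c b),
        [/\ L a c l, R c b r & f = comp r l]].

Definition two_of_three (C : category) (W : morclass C) : Prop :=
  forall (a b c : C) (f : hom a b) (g : hom b c),
    [/\ W a b f -> W b c g -> W a c (comp g f),
        W a b f -> W a c (comp g f) -> W b c g &
        W b c g -> W a c (comp g f) -> W a b f].

Definition is_model_structure (C : category) (we cof fib : subcategory C)
    : Prop :=
  [/\ is_wfs cof (morclassI fib we),
      is_wfs (morclassI cof we) fib &
      two_of_three we].

(* Two-sorted first-order syntax.  O and M are the types of free variables of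
   the sort of objects and of the sort of morphisms; a quantifier binds the
   variable None of option O (resp. option M).  Composition is partial, so it is
   represented by its graph: Fcomp g f h says that h is the composite of f
   followed by g. *)
Inductive oterm (O M : Type) : Type :=
| Ovar of O
| Osrc of mterm O M
| Otgt of mterm O M
with mterm (O M : Type) : Type :=
| Mvar of M
| Mid of oterm O M.

Inductive formula (O M : Type) : Type :=
| Fbot
| Feqo of oterm O M & oterm O M
| Feqm of mterm O M & mterm O M
| Fcomp of mterm O M & mterm O M & mterm O M
| Fsubo of oterm O M
| Fsubm of mterm O M
| Fimp of formula O M & formula O M
| Fand of formula O M & formula O M
| For of formula O M & formula O M
| Fallo of formula (option O) M
| Fallm of formula O (option M)
| Fexo of formula (option O) M
| Fexm of formula O (option M).

Definition sentence := formula void void.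

Record arrow (C : category) := Arrow {
  asrc : C;
  atgt : C;
  amor : hom asrc atgt }.

Definition arrow_comp (C : category) (g f h : arrow C) : Prop :=
  exists (a b c : C) (v : hom b c) (u : hom a b),
    [/\ g = Arrow v, f = Arrow u & h = Arrow (comp v u)].

Fixpoint oeval (C : category) (O M : Type) (eo : O -> C) (em : M -> arrow C)
    (t : oterm O M) : C :=
  match t with
  | Ovar x => eo x
  | Osrc m => asrc (meval eo em m)
  | Otgt m => atgt (meval eo em m)
  end
with meval (C : category) (O M : Type) (eo : O -> C) (em : M -> arrow C)
    (t : mterm O M) : arrow C :=
  match t with
  | Mvar x => em x
  | Mid o => Arrow (idc (oeval eo em o))
  end.

Fixpoint sat (C : category) (W : subcategory C) (O M : Type)
    (p : formula O M) : (O -> C) -> (M -> arrow C) -> Prop :=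
  match p with
  | Fbot => fun _ _ => False
  | Feqo s t => fun eo em => oeval eo em s = oeval eo em t
  | Feqm s t => fun eo em => meval eo em s = meval eo em t
  | Fcomp g f h => fun eo em =>
      arrow_comp (meval eo em g) (meval eo em f) (meval eo em h)
  | Fsubo t => fun eo em => sob W (oeval eo em t)
  | Fsubm t => fun eo em => smor W (amor (meval eo em t))
  | Fimp q r => fun eo em => sat W q eo em -> sat W r eo em
  | Fand q r => fun eo em => sat W q eo em /\ sat W r eo em
  | For q r => fun eo em => sat W q eo em \/ sat W r eo em
  | Fallo q => fun eo em => forall x : C, sat W q (oapp eo x) em
  | Fallm q => fun eo em => forall f : arrow C, sat W q eo (oapp em f)
  | Fexo q => fun eo em => exists x : C, sat W q (oapp eo x) em
  | Fexm q => fun eo em => exists f : arrow C, sat W q eo (oapp em f)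
  end.

Definition models (C : category) (W : subcategory C) (s : sentence) : Prop :=
  sat W s (@of_void C) (@of_void (arrow C)).

(* Main.v *)
(** In a model structure on a poset, each class of weak equivalences contains
    exactly one bifibrant object, its center, and the centers form a monotone
    section [chi] with [QA <= chi A <= RA].  Conversely, let [chi] be a monotone
    choice of one object in each class such that every [A] admits weak
    equivalences [a -> A -> b] with [a <= chi A <= b].  Then
      cof = {A <= B | B <= A \/ chi B},
      fib = {A <= B | B /\ (A \/ chi A) <= A}
    complete [W] to a model structure.

    Being an admissible center [x] of its own class and being bounded by
    admissible centers of all comparable classes is a first-order property of
    [x].  The objects having it are such that if the class of [x] is below
    the class of [y], then [x \/ y] has the property in the class of [y], and
    [x /\ y] in the class of [x].  Hence a finite monotone family of such
    centers always extends to one more class, namely by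
    [(d \/ lower centers) /\ upper centers] with [d] arbitrary, and countably
    many classes are treated one after the other. *)
Require Import Defs.
From Stdlib Require Import Relation_Operators List.
From mathcomp Require Import all_boot.
From mathcomp Require Import boolp classical_sets functions cardinality.

Set Implicit Arguments.
Unset Strict Implicit.
Unset Printing Implicit Defensive.

Local Open Scope classical_set_scope.

(** * The homotopy order and its centers *)

Section Relations.
Variables (C : category) (W : subcategory C).

Definition cle (a b : C) : Prop := inhabited (hom a b).
Definition weq (a b : C) : Prop := exists f : hom a b, smor W f.

(* The order of the homotopy category. *)
Definition hle (a b : C) : Prop :=
  exists u v, [/\ weq u a, weq b v & cle u v].
Definition heq (a b : C) : Prop := hle a b /\ hle b a.

(** In a model structure the bifibrant object of a class has this property, with the cofibrant
    replacement of [a] as [u] and the fibrant one as [v]. *)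
Definition center (x : C) : Prop :=
  forall a, heq a x ->
    (exists u, weq u a /\ cle u x) /\ (exists v, weq a v /\ cle x v).

(** First-order logic cannot quantify over monotone families of centers through [x]; this keeps only
    their trace on one comparable class at a time. *)
Definition tame_center (x : C) : Prop :=
  center x /\
  forall a,
    (hle x a -> exists y, [/\ heq y a, center y & cle x y]) /\
    (hle a x -> exists y, [/\ heq y a, center y & cle y x]).

(** The first three clauses make the weak equivalences the pairs [a <= b] with [b] below [a] in a
    preorder, which yields two-of-three. *)
Definition center_axioms : Prop :=
  [/\ forall a, weq a a,
      forall a b c, hle a b -> hle b c -> hle a c,
      forall a b, cle a b -> hle b a -> weq a b &
      forall a, exists x, heq x a /\ tame_center x].

End Relations.

(** * First-order formulas for these notions *)

Section Formulas.

Definition Fand3 (O M : Type) (p q r : formula O M) := Fand p (Fand q r).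

(** The parameters are variables, not terms, so moving a formula under an object quantifier only
    prefixes them with [Some]. *)
Definition Fcle (O M : Type) (a b : O) : formula O M :=
  Fexm (Fand (Feqo (Osrc (Mvar _ None)) (Ovar _ a))
             (Feqo (Otgt (Mvar _ None)) (Ovar _ b))).

Definition Fweq (O M : Type) (a b : O) : formula O M :=
  Fexm (Fand3 (Fsubm (Mvar _ None))
             (Feqo (Osrc (Mvar _ None)) (Ovar _ a))
             (Feqo (Otgt (Mvar _ None)) (Ovar _ b))).

(** In the body, [Some None] stands for the [u] of [hle] and [None] for its [v]. *)
Definition Fhle (O M : Type) (a b : O) : formula O M :=
  Fexo (Fexo (Fand3 (Fweq M (Some None) (Some (Some a)))
                    (Fweq M (Some (Some b)) None)
                    (Fcle M (Some None) None))).

Definition Fheq (O M : Type) (a b : O) : formula O M :=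
  Fand (Fhle M a b) (Fhle M b a).

Definition Fcenter (O M : Type) (x : O) : formula O M :=
  Fallo (Fimp (Fheq M None (Some x))
    (Fand (Fexo (Fand (Fweq M None (Some None)) (Fcle M None (Some (Some x)))))
          (Fexo (Fand (Fweq M (Some None) None)
                      (Fcle M (Some (Some x)) None))))).

Definition Ftame_center (O M : Type) (x : O) : formula O M :=
  Fand (Fcenter M x) (Fallo (Fand
    (Fimp (Fhle M (Some x) None)
      (Fexo (Fand3 (Fheq M None (Some None)) (Fcenter M None)
                   (Fcle M (Some (Some x)) None))))
    (Fimp (Fhle M None (Some x))
      (Fexo (Fand3 (Fheq M None (Some None)) (Fcenter M None)
                   (Fcle M None (Some (Some x)))))))).

Definition Fcenter_axioms : sentence :=
  Fand (Fallo (Fweq _ None None))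
  (Fand3
    (Fallo (Fallo (Fallo (Fimp (Fhle _ (Some (Some None)) (Some None))
       (Fimp (Fhle _ (Some None) None) (Fhle _ (Some (Some None)) None))))))
    (Fallo (Fallo (Fimp (Fcle _ (Some None) None)
       (Fimp (Fhle _ None (Some None)) (Fweq _ (Some None) None)))))
    (Fallo (Fexo (Fand (Fheq _ None (Some None)) (Ftame_center _ None))))).

End Formulas.

(** * Correctness of the formulas *)

Section Satisfaction.
Variables (C : category) (W : subcategory C).

Section Connectives.
Variables (O M : Type) (eo : O -> C) (em : M -> arrow C).

Lemma sat_Fand (p q : formula O M) (P Q : Prop) :
  (sat W p eo em <-> P) -> (sat W q eo em <-> Q) ->
  (sat W (Fand p q) eo em <-> P /\ Q).
Proof. by move=> [? ?] [? ?]; split=> -[? ?]; split; auto. Qed.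

Lemma sat_Fand3 (p q r : formula O M) (P Q R : Prop) :
  (sat W p eo em <-> P) -> (sat W q eo em <-> Q) -> (sat W r eo em <-> R) ->
  (sat W (Fand3 p q r) eo em <-> [/\ P, Q & R]).
Proof.
move=> hp hq hr; have [h1 h2] := sat_Fand hp (sat_Fand hq hr).
by split=> [/h1[? []]|[? ? ?]]; [split|apply: h2].
Qed.

Lemma sat_Fimp (p q : formula O M) (P Q : Prop) :
  (sat W p eo em <-> P) -> (sat W q eo em <-> Q) ->
  (sat W (Fimp p q) eo em <-> (P -> Q)).
Proof. by move=> [? ?] [? ?]; split=> /= ? ?; auto. Qed.

Lemma sat_Fallo (p : formula (option O) M) (P : C -> Prop) :
  (forall x, sat W p (oapp eo x) em <-> P x) ->
  (sat W (Fallo p) eo em <-> forall x, P x).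
Proof. by move=> pP; split=> h x; apply/pP; apply: h. Qed.

Lemma sat_Fexo (p : formula (option O) M) (P : C -> Prop) :
  (forall x, sat W p (oapp eo x) em <-> P x) ->
  (sat W (Fexo p) eo em <-> exists x, P x).
Proof. by move=> pP; split=> -[x ?]; exists x; apply/pP. Qed.

Lemma sat_Fcle (a b : O) : sat W (Fcle M a b) eo em <-> cle (eo a) (eo b).
Proof.
split => [[[s t f] /= [<- <-]]|[f]]; first by constructor.
by exists (Arrow f).
Qed.

Lemma sat_Fweq (a b : O) : sat W (Fweq M a b) eo em <-> weq W (eo a) (eo b).
Proof.
split => [[[s t f] /= [Wf [<- <-]]]|[f Wf]]; first by exists f.
by exists (Arrow f).
Qed.

End Connectives.

Lemma sat_Fhle (O M : Type) (a b : O) (eo : O -> C) (em : M -> arrow C) :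
  sat W (Fhle M a b) eo em <-> hle W (eo a) (eo b).
Proof.
by do 2!apply: sat_Fexo => ?; apply: sat_Fand3;
  [apply: sat_Fweq|apply: sat_Fweq|apply: sat_Fcle].
Qed.

Lemma sat_Fheq (O M : Type) (a b : O) (eo : O -> C) (em : M -> arrow C) :
  sat W (Fheq M a b) eo em <-> heq W (eo a) (eo b).
Proof. by apply: sat_Fand; apply: sat_Fhle. Qed.

Lemma sat_Fcenter (O M : Type) (x : O) (eo : O -> C) (em : M -> arrow C) :
  sat W (Fcenter M x) eo em <-> center W (eo x).
Proof.
apply: sat_Fallo => ?; apply: sat_Fimp; first exact: sat_Fheq.
by apply: sat_Fand; apply: sat_Fexo => ?; apply: sat_Fand;
  [exact: sat_Fweq|exact: sat_Fcle|exact: sat_Fweq|exact: sat_Fcle].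
Qed.

Lemma sat_Ftame_center (O M : Type) (x : O) (eo : O -> C) (em : M -> arrow C) :
  sat W (Ftame_center M x) eo em <-> tame_center W (eo x).
Proof.
apply: sat_Fand; first exact: sat_Fcenter.
apply: sat_Fallo => ?; apply: sat_Fand; apply: sat_Fimp; try exact: sat_Fhle.
  by apply: sat_Fexo => ?; apply: sat_Fand3;
    [exact: sat_Fheq|exact: sat_Fcenter|exact: sat_Fcle].
by apply: sat_Fexo => ?; apply: sat_Fand3;
  [exact: sat_Fheq|exact: sat_Fcenter|exact: sat_Fcle].
Qed.

Lemma models_center_axioms : models W Fcenter_axioms <-> center_axioms W.
Proof.
have -> : center_axioms W <-> (forall a, weq W a a) /\
  [/\ forall a b c, hle W a b -> hle W b c -> hle W a c,
      forall a b, cle a b -> hle W b a -> weq W a b &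
      forall a, exists x, heq W x a /\ tame_center W x].
  by split=> [[]|[? []]].
apply: sat_Fand; first by apply: sat_Fallo => ?; apply: sat_Fweq.
apply: sat_Fand3.
- do 3!apply: sat_Fallo => ?; apply: sat_Fimp; first exact: sat_Fhle.
  by apply: sat_Fimp; apply: sat_Fhle.
- do 2!apply: sat_Fallo => ?; apply: sat_Fimp; first exact: sat_Fcle.
  by apply: sat_Fimp; [exact: sat_Fhle|exact: sat_Fweq].
- apply: sat_Fallo => ?; apply: sat_Fexo => ?.
  by apply: sat_Fand; [exact: sat_Fheq|exact: sat_Ftame_center].
Qed.

End Satisfaction.

(** * The category as an order with finite meets and joins *)

Section Poset.
Variable C : category.
Hypothesis posetC : is_poset C.

Lemma cle_refl (a : C) : cle a a.
Proof. by constructor; apply: idc. Qed.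

Lemma cle_trans (b a c : C) : cle a b -> cle b c -> cle a c.
Proof. by move=> [f] [g]; constructor; exact: Defs.comp g f. Qed.

Lemma hom_eq (a b : C) (f g : hom a b) : f = g.
Proof. by case: posetC => + _; apply. Qed.

Lemma cle_anti (a b : C) : cle a b -> cle b a -> a = b.
Proof.
move=> [f] [g]; have [_] := posetC; apply.
by exists f, g; split; apply: hom_eq.
Qed.

Lemma liftsE (a b x y : C) (f : hom a b) (g : hom x y) :
  lifts f g <-> (cle a x -> cle b y -> cle b x).
Proof.
split=> [fg [u] [v]|h u v _].
  by have [|k _] := fg u v; [apply: hom_eq|constructor].
have [||k] := h; [by constructor|by constructor|].
by exists k; split; apply: hom_eq.
Qed.

Lemma cle_of_lifts (a b x y : C) (f : hom a b) (g : hom x y) :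
  lifts f g -> cle a x -> cle b y -> cle b x.
Proof. by move/liftsE. Qed.

Section Bounds.
Hypothesis bicompleteC : finitely_bicomplete C.

(** A limit over a finite discrete diagram is a meet and a colimit is a join; finite bicompleteness
    enters only through these. *)
Definition discrete_category (I : Type) : category :=
  @Category I (fun i j => i = j) (fun=> erefl) (fun a b c g f => eq_trans f g)
    (fun _ _ _ => Prop_irrelevance _ _) (fun _ _ _ => Prop_irrelevance _ _)
    (fun _ _ _ _ _ _ _ => Prop_irrelevance _ _).

Definition discrete_functor (I : Type) (F : I -> C) :
    functor (discrete_category I) C :=
  @Functor (discrete_category I) C F
    (fun i j (u : i = j) => match u in _ = k return hom (F i) (F k) with
                            | erefl => idc (F i) end)
    (fun _ => hom_eq _ _) (fun _ _ _ _ _ => hom_eq _ _).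

Lemma finite_discrete_category (I : finType) :
  finite_category (discrete_category I).
Proof.
split=> [|i j]; first exact: (@finite_finset I setT).
have [[u]|ij] := pselect (inhabited (i = j)).
  by apply: (@sub_finite_set _ _ [set u]) => // v _; apply: Prop_irrelevance.
by apply: (@sub_finite_set _ _ set0) => // v _; apply: ij; constructor.
Qed.

Lemma exists_glb (I : finType) (F : I -> C) :
  exists m, (forall i, cle m (F i)) /\
            (forall b, (forall i, cle b (F i)) -> cle b m).
Proof.
have [[m [p [_ univ]]] _] :=
  bicompleteC (finite_discrete_category I) (discrete_functor F).
exists m; split=> [i|b bF]; first by constructor; apply: p.
pose q i := inhabited_witness (bF i).
have [|h _] := univ b q; first by move=> *; apply: hom_eq.
by constructor.
Qed.

Lemma exists_lub (I : finType) (F : I -> C) :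
  exists m, (forall i, cle (F i) m) /\
            (forall b, (forall i, cle (F i) b) -> cle m b).
Proof.
have [_ [m [p [_ univ]]]] :=
  bicompleteC (finite_discrete_category I) (discrete_functor F).
exists m; split=> [i|b bF]; first by constructor; apply: p.
pose q i := inhabited_witness (bF i).
have [|h _] := univ b q; first by move=> *; apply: hom_eq.
by constructor.
Qed.

Lemma exists_bottom : exists z : C, forall a, cle z a.
Proof.
have [z [_ zP]] := exists_lub (@of_void C).
by exists z => a; apply: zP; case.
Qed.

Lemma exists_top : exists z : C, forall a, cle a z.
Proof.
have [z [_ zP]] := exists_glb (@of_void C).
by exists z => a; apply: zP; case.
Qed.

Lemma exists_meet (a b : C) :
  exists m, [/\ cle m a, cle m b & forall c, cle c a -> cle c b -> cle c m].
Proof.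
have [m [mP mU]] := exists_glb (fun i : bool => if i then a else b).
exists m; split; [exact: (mP true)|exact: (mP false)|].
by move=> c ca cb; apply: mU => -[].
Qed.

Lemma exists_join (a b : C) :
  exists m, [/\ cle a m, cle b m & forall c, cle a c -> cle b c -> cle m c].
Proof.
have [m [mP mU]] := exists_lub (fun i : bool => if i then a else b).
exists m; split; [exact: (mP true)|exact: (mP false)|].
by move=> c ca cb; apply: mU => -[].
Qed.

Lemma exists_meet_op : exists meet : C -> C -> C, forall a b,
  [/\ cle (meet a b) a, cle (meet a b) b &
      forall c, cle c a -> cle c b -> cle c (meet a b)].
Proof.
by exists (fun a b => projT1 (cid (exists_meet a b))) => a b; case: cid.
Qed.

Lemma exists_join_op : exists join : C -> C -> C, forall a b,
  [/\ cle a (join a b), cle b (join a b) &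
      forall c, cle a c -> cle b c -> cle (join a b) c].
Proof.
by exists (fun a b => projT1 (cid (exists_join a b))) => a b; case: cid.
Qed.

End Bounds.
End Poset.

(** * A model structure satisfies the center axioms *)

Section Necessity.
Variables (C : category) (W : subcategory C).
Hypotheses (posetC : is_poset C) (bicompleteC : finitely_bicomplete C).
Variables cof fib : subcategory C.
Hypothesis modelW : is_model_structure W cof fib.

Notation tcof := (morclassI cof W).
Notation tfib := (morclassI fib W).

Lemma weq_comp a b c : weq W a b -> weq W b c -> weq W a c.
Proof. by move=> [f Wf] [g Wg]; exists (Defs.comp g f); apply: smor_comp. Qed.

Lemma weq_le a b : weq W a b -> cle a b.
Proof. by move=> [f _]. Qed.

Lemma weq_left a b c : cle a b -> weq W b c -> weq W a c -> weq W a b.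
Proof.
have [_ _ W23] := modelW; move=> [f] [g Wg] [h Wh]; exists f.
by have [_ _] := W23 _ _ _ f g; apply=> //;
  rewrite (hom_eq posetC (Defs.comp g f) h).
Qed.

Lemma weq_right a b c : cle b c -> weq W a b -> weq W a c -> weq W b c.
Proof.
have [_ _ W23] := modelW; move=> [f] [g Wg] [h Wh]; exists f.
by have [_ + _] := W23 _ _ _ g f; apply=> //;
  rewrite (hom_eq posetC (Defs.comp f g) h).
Qed.

Lemma cof_lift a b x y (f : hom a b) (g : hom x y) :
  smor cof f -> smor fib g -> smor W g -> cle a x -> cle b y -> cle b x.
Proof.
have [[cofE _ _] _ _] := modelW; rewrite cofE => fL gF gW.
by apply: cle_of_lifts (fL _ _ g _).
Qed.

Lemma fib_lift a b x y (f : hom a b) (g : hom x y) :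
  smor cof f -> smor W f -> smor fib g -> cle a x -> cle b y -> cle b x.
Proof.
have [_ [_ fibE _] _] := modelW; rewrite fibE => fC fW gR.
by apply: cle_of_lifts (gR _ _ f _).
Qed.

(** For a least object [z] this says that [z -> a] lifts on the left of every trivial fibration, the
    top of the square being automatic. *)
Definition cofibrant (a : C) : Prop :=
  forall x y (g : hom x y), smor fib g -> smor W g -> cle a y -> cle a x.

Definition fibrant (a : C) : Prop :=
  forall x y (f : hom x y), smor cof f -> smor W f -> cle x a -> cle y a.

Lemma exists_cofibrant_replacement a : exists q,
  cofibrant q /\ exists f : hom q a, smor fib f /\ smor W f.
Proof.
have [z z_le] := exists_bottom posetC bicompleteC.
have [[_ _ fact] _ _] := modelW.
have [q [f [g [fC [gF gW] _]]]] := fact _ _ (inhabited_witness (z_le a)).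
exists q; split; last by exists g.
by move=> x y h hF hW; apply: (cof_lift fC hF hW).
Qed.

Lemma exists_fibrant_replacement a : exists r,
  fibrant r /\ exists f : hom a r, smor cof f /\ smor W f.
Proof.
have [z le_z] := exists_top posetC bicompleteC.
have [_ [_ _ fact] _] := modelW.
have [r [f [g [[fC fW] gF _]]]] := fact _ _ (inhabited_witness (le_z a)).
exists r; split; last by exists f.
by move=> x y h hC hW xr; apply: (fib_lift hC hW gF xr).
Qed.

(** A form of Whitehead's theorem. Factor [x -> y] as a trivial cofibration to [z] and a fibration,
    which is trivial by two-of-three; fibrancy of [x] gives [z <= x] and cofibrancy of [y] gives
    [y <= z]. *)
Lemma weq_bifibrant x y : weq W x y -> fibrant x -> cofibrant y -> x = y.
Proof.
move=> xy fx cy; have [h Wh] := xy.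
have [_ [_ _ fact] _] := modelW.
have [z [f [g [[fC fW] gF _]]]] := fact _ _ h.
apply: (cle_anti posetC); first exact: weq_le xy.
have zx : cle z x by apply: fx fC fW _; apply: cle_refl.
apply: cle_trans zx; apply: cy (cle_refl _) => //; first exact: gF.
have [k Wk] : weq W z y.
  by apply: (@weq_right x); [constructor|exists f|].
by rewrite (hom_eq posetC g k).
Qed.

Lemma cofibrant_target q r (f : hom q r) :
  cofibrant q -> smor cof f -> cofibrant r.
Proof.
move=> cq fC x y g gF gW ry; apply: (cof_lift fC gF gW _ ry).
by apply: cq gF gW _; apply: cle_trans ry; constructor.
Qed.

Lemma model_center_axioms : center_axioms W.
Proof.
have [Q Qall] := choice exists_cofibrant_replacement.
have [R Rall] := choice exists_fibrant_replacement.
have Qc a : cofibrant (Q a) by case: (Qall a).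
have Rf a : fibrant (R a) by case: (Rall a).
have QW a : weq W (Q a) a by case: (Qall a) => _ [f [_ ?]]; exists f.
have RW a : weq W a (R a) by case: (Rall a) => _ [f [_ ?]]; exists f.
have Qmono a b : cle a b -> cle (Q a) (Q b).
  move=> ab; have [_ [f [fF fW]]] := Qall b; apply: (Qc a _ _ f) => //.
  by apply: cle_trans ab; apply: weq_le.
have Rmono a b : cle a b -> cle (R a) (R b).
  move=> ab; have [_ [f [fF fW]]] := Rall a; apply: (Rf b _ _ f) => //.
  by apply: cle_trans (ab) _; apply: weq_le.
have Rc a : cofibrant a -> cofibrant (R a).
  move=> ca; have [_ [f [fC _]]] := Rall a.
  exact: cofibrant_target ca fC.
have QmonoW a b : weq W a b -> weq W (Q a) (Q b).
  move=> ab; apply: (@weq_left _ _ b) => //; first exact/Qmono/weq_le.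
  exact: weq_comp ab.
have RmonoW a b : weq W a b -> weq W (R a) (R b).
  move=> ab; apply: (@weq_right a) => //; first exact/Rmono/weq_le.
  exact: weq_comp ab _.
pose chi a := R (Q a).
(* [chi a] is fibrant, [chi b] is cofibrant, and they are weakly equivalent because [Q] and [R]
   preserve weak equivalences. *)
have chiW a b : weq W a b -> chi a = chi b.
  move=> ab; apply: weq_bifibrant; last exact/Rc/Qc; last exact: Rf.
  exact/RmonoW/QmonoW.
have chi_mono a b : cle a b -> cle (chi a) (chi b).
  by move=> ?; apply/Rmono/Qmono.
have W_chi a : weq W (Q a) (chi a) by apply: RW.
have chi_le a : cle (chi a) (R a) by apply/Rmono/weq_le.
(* Backwards, the witness is [Q a <= chi a <= chi b <= R b]. *)
have hleE a b : hle W a b <-> cle (chi a) (chi b).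
  split=> [[u [v [/chiW<- /chiW-> uv]]]|ab]; first exact: chi_mono.
  exists (Q a), (R b); split=> //; apply: cle_trans (chi_le b).
  by apply: cle_trans ab; apply: weq_le.
have heqE a b : heq W a b <-> chi a = chi b.
  split=> [[/hleE ab /hleE ba]|ab]; first exact: cle_anti.
  by split; apply/hleE; rewrite ab; apply: cle_refl.
have chiK a : chi (chi a) = chi a.
  by rewrite -(chiW _ _ (W_chi a)) (chiW _ _ (QW a)).
have chi_center a : center W (chi a).
  move=> b /heqE; rewrite chiK => ba; split.
    by exists (Q b); split=> //; rewrite -ba; apply: weq_le.
  by exists (R b); split=> //; rewrite -ba.
split=> [a|a b c|a b ab /hleE ba|a].
- have [f Wf] := QW a; exists (idc a); exact: smor_id (smor_tgt Wf).
- by move=> /hleE ab /hleE bc; apply/hleE; apply: cle_trans bc.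
(* Two-of-three turns [Q a -> chi b] and [Q b -> chi b] into a weak equivalence [Q a -> Q b], and
   then makes [a -> b] one. *)
- have chi_ab : chi a = chi b by apply: cle_anti => //; apply: chi_mono.
  apply: (@weq_right (Q a)) => //; apply: weq_comp (QW b).
  by apply: (@weq_left _ _ (chi b)) => //; [apply: Qmono|rewrite -chi_ab].
(* Tameness is immediate: [chi b] is the required center in every class comparable to that of
   [a]. *)
- exists (chi a); split; first by apply/heqE.
  split=> // b; split=> /hleE ab; exists (chi b); split=> //; try exact/heqE;
    by rewrite chiK in ab.
Qed.

End Necessity.

(** The retract argument: a morphism lifting against one factor of its own factorization makes that
    factor invertible, hence an identity in a poset, so the morphism is the other factor. *)
Lemma poset_wfs (C : category) (L R : morclass C) :
  is_poset C ->
  (forall a b x y (f : hom a b) (g : hom x y), L a b f -> R x y g ->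
    cle a x -> cle b y -> cle b x) ->
  (forall a b, cle a b -> exists c (l : hom a c) (r : hom c b),
    L a c l /\ R c b r) ->
  is_wfs L R.
Proof.
move=> posetC lift fact.
have LR a b x y (f : hom a b) (g : hom x y) : L a b f -> R x y g -> lifts f g.
  by move=> fL gR; apply/(liftsE posetC); apply: lift fL gR.
split.
- apply: functional_extensionality_dep => a.
  apply: functional_extensionality_dep => b.
  apply/funext => f; apply/propext.
  split=> [fL x y g|fLLP]; first exact: LR.
  have [c [l [r [lL rR]]]] := fact a b (inhabits f).
  have bc := cle_of_lifts posetC (fLLP _ _ r rR) (inhabits l) (cle_refl b).
  have ? : c = b := cle_anti posetC (inhabits r) bc.
  by subst c; rewrite (hom_eq posetC f l).
- apply: functional_extensionality_dep => x.
  apply: functional_extensionality_dep => y.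
  apply/funext => g; apply/propext.
  split=> [gR a b f fL|gRLP]; first exact: LR.
  have [c [l [r [lL rR]]]] := fact x y (inhabits g).
  have cx := cle_of_lifts posetC (gRLP _ _ l lL) (cle_refl x) (inhabits r).
  have ? : c = x := cle_anti posetC cx (inhabits l).
  by subst c; rewrite (hom_eq posetC g r).
- move=> a b f; have [c [l [r [lL rR]]]] := fact a b (inhabits f).
  by exists c, l, r; split=> //; apply: hom_eq.
Qed.

(** * A model structure from a monotone choice of centers *)

Section CenterAxioms.
Variables (C : category) (W : subcategory C).
Hypotheses (posetC : is_poset C) (axW : center_axioms W).

Lemma hle_trans b a c : hle W a b -> hle W b c -> hle W a c.
Proof. by case: axW => _ + _ _; apply. Qed.

Lemma weq_refl a : weq W a a.
Proof. by case: axW. Qed.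

Lemma cle_hle a b : cle a b -> hle W a b.
Proof. by exists a, b; split=> //; apply: weq_refl. Qed.

Lemma weqE a b : weq W a b <-> cle a b /\ hle W b a.
Proof.
split=> [ab|[ab ba]]; last by case: axW => _ _ + _; apply.
split; first by case: ab => f _; constructor.
by exists a, a; split=> //; [apply: weq_refl|apply: cle_refl].
Qed.

Lemma heq_refl a : heq W a a.
Proof. by split; apply/cle_hle/cle_refl. Qed.

Lemma heq_sym a b : heq W a b -> heq W b a.
Proof. by case. Qed.

Lemma heq_trans b a c : heq W a b -> heq W b c -> heq W a c.
Proof. by move=> [ab ba] [bc cb]; split; apply: hle_trans; eassumption. Qed.

Section Construction.
Variables (meet join : C -> C -> C) (chi : C -> C).
Hypothesis meetP : forall a b,
  [/\ cle (meet a b) a, cle (meet a b) b &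
      forall c, cle c a -> cle c b -> cle c (meet a b)].
Hypothesis joinP : forall a b,
  [/\ cle a (join a b), cle b (join a b) &
      forall c, cle a c -> cle b c -> cle (join a b) c].
Hypothesis chi_heq : forall a, heq W (chi a) a.
Hypothesis chi_center : forall a, center W (chi a).
Hypothesis chi_mono : forall a b, hle W a b -> cle (chi a) (chi b).

Lemma meet_lel a b : cle (meet a b) a. Proof. by case: (meetP a b). Qed.
Lemma meet_ler a b : cle (meet a b) b. Proof. by case: (meetP a b). Qed.
Lemma le_meet c a b : cle c a -> cle c b -> cle c (meet a b).
Proof. by case: (meetP a b) => _ _; apply. Qed.
Lemma le_joinl a b : cle a (join a b). Proof. by case: (joinP a b). Qed.
Lemma le_joinr a b : cle b (join a b). Proof. by case: (joinP a b). Qed.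
Lemma join_le a b c : cle a c -> cle b c -> cle (join a b) c.
Proof. by case: (joinP a b) => _ _; apply. Qed.

Lemma join_mono a b c d : cle a c -> cle b d -> cle (join a b) (join c d).
Proof.
move=> ac bd; apply: join_le.
  by apply: cle_trans ac _; apply: le_joinl.
by apply: cle_trans bd _; apply: le_joinr.
Qed.

(** Since [chi b] is a center, some [u] weakly equivalent to [b] lies below [meet b (chi b)], hence
    below [z]. *)
Lemma weq_above_meet z b : cle (meet b (chi b)) z -> cle z b -> weq W z b.
Proof.
move=> mz zb; apply/weqE; split=> //.
have [[u [/weqE[ub bu] uchi]] _] := chi_center (heq_sym (chi_heq b)).
by apply: hle_trans bu (cle_hle _); apply: cle_trans mz; apply: le_meet.
Qed.

Lemma weq_below_join a z : cle a z -> cle z (join a (chi a)) -> weq W a z.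
Proof.
move=> az zj; apply/weqE; split=> //.
have [_ [v [/weqE[av va] chiv]]] := chi_center (heq_sym (chi_heq a)).
by apply: hle_trans (cle_hle _) va; apply: cle_trans zj _; apply: join_le.
Qed.

Lemma weq_chi a b : weq W a b -> chi a = chi b.
Proof.
move=> /weqE[ab ba]; apply: (cle_anti posetC); apply: chi_mono => //.
exact: cle_hle.
Qed.

Lemma center_cof_comp (a b c : C) : cle b c ->
  cle c (join b (chi c)) -> cle b (join a (chi b)) -> cle c (join a (chi c)).
Proof.
move=> bc cb ba; apply: cle_trans cb _; apply: join_le; last exact: le_joinr.
apply: cle_trans ba _; apply: join_mono; first exact: cle_refl.
exact/chi_mono/cle_hle.
Qed.

Lemma center_fib_comp (a b c : C) : cle a b ->
  cle (meet c (join b (chi b))) b -> cle (meet b (join a (chi a))) a ->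
  cle (meet c (join a (chi a))) a.
Proof.
move=> ab cb; apply: cle_trans; apply: le_meet; last exact: meet_ler.
apply: cle_trans cb; apply: le_meet; first exact: meet_lel.
apply: cle_trans (meet_ler _ _) _; apply: join_mono => //.
exact/chi_mono/cle_hle.
Qed.

Definition center_cof : subcategory C :=
  @Subcategory C setT (fun a b => [set _ | cle b (join a (chi b))])
    (fun _ _ _ _ => I) (fun _ _ _ _ => I) (fun a _ => le_joinl _ _)
    (fun a b c g f => center_cof_comp (inhabits g)).

Definition center_fib : subcategory C :=
  @Subcategory C setT (fun a b => [set _ | cle (meet b (join a (chi a))) a])
    (fun _ _ _ _ => I) (fun _ _ _ _ => I) (fun a _ => meet_lel _ _)
    (fun a b c g f => @center_fib_comp a b c (inhabits f)).

Lemma center_model_structure : is_model_structure W center_cof center_fib.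
Proof.
split.
- apply: poset_wfs => // [a b x y f g fL [gF gW] ax by_|a b ab].
    (* The lift is [b <= y /\ (x \/ chi x) <= x]: indeed [b <= a \/ chi b], with [a <= x] and
       [chi b <= chi y = chi x]. *)
    apply: cle_trans gF; apply: le_meet => //; apply: cle_trans fL _.
    apply: join_mono => //; rewrite (@weq_chi x y); last by exists g.
    exact/chi_mono/cle_hle.
  (* [z] is the largest object below both [b] and [a \/ chi b]. It lies above [b /\ chi b], so it is
     weakly equivalent to [b] and [chi z = chi b]. *)
  pose z := meet b (join a (chi b)).
  have [zb za] : cle z b /\ cle z (join a (chi b)).
    by split; [apply: meet_lel|apply: meet_ler].
  have az : cle a z by apply: le_meet ab _; apply: le_joinl.
  have wzb : weq W z b.
    apply: weq_above_meet zb; apply: le_meet; first exact: meet_lel.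
    by apply: cle_trans (meet_ler _ _) _; apply: le_joinr.
  have [r Wr] := wzb; exists z, (inhabited_witness az), r; split.
    by rewrite /= (weq_chi wzb).
  split=> //; apply: le_meet; first exact: meet_lel.
  apply: cle_trans (meet_ler _ _) _; apply: join_le => //.
  by rewrite (weq_chi wzb); apply: le_joinr.
- apply: poset_wfs => // [a b x y f g [fL fW] gF ax by_|a b ab].
    apply: cle_trans gF; apply: le_meet => //; apply: cle_trans fL _.
    apply: join_mono => //; rewrite -(@weq_chi a b); last by exists f.
    exact/chi_mono/cle_hle.
  (* Now [z] lies between [a] and [a \/ chi a], so it is weakly equivalent to [a] instead. *)
  pose z := meet b (join a (chi a)).
  have [zb za] : cle z b /\ cle z (join a (chi a)).
    by split; [apply: meet_lel|apply: meet_ler].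
  have az : cle a z by apply: le_meet ab _; apply: le_joinl.
  have waz : weq W a z by apply: weq_below_join.
  have [l Wl] := waz; exists z, l, (inhabited_witness zb); split.
    by split=> //=; rewrite -(weq_chi waz).
  apply: le_meet; first exact: meet_lel.
  apply: cle_trans (meet_ler _ _) _; apply: join_le => //.
  by rewrite -(weq_chi waz); apply: le_joinr.
(* Weak equivalences are the morphisms reversed by [hle], so two-of-three reduces to
   transitivity. *)
- have smorE a b (f : hom a b) : smor W f <-> hle W b a.
    split=> [Wf|ba]; first by have /weqE[] : weq W a b by exists f.
    have [g Wg] : weq W a b by apply/weqE; split=> //; constructor.
    by rewrite (hom_eq posetC f g).
  move=> a b c f g.
  have [fab gbc] := (cle_hle (inhabits f), cle_hle (inhabits g)).
  by split=> /smorE h /smorE k; apply/smorE; apply: hle_trans; eassumption.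
Qed.

End Construction.
End CenterAxioms.

(** * Choosing centers for countably many classes *)

Section Choice.
Variables (C : category) (W : subcategory C).
Hypothesis axW : center_axioms W.
Variables (meet join : C -> C -> C).
Hypothesis meetP : forall a b,
  [/\ cle (meet a b) a, cle (meet a b) b &
      forall c, cle c a -> cle c b -> cle c (meet a b)].
Hypothesis joinP : forall a b,
  [/\ cle a (join a b), cle b (join a b) &
      forall c, cle a c -> cle b c -> cle (join a b) c].

(** The lower witness for [x] and the upper witness for [y] serve for [z]. *)
Lemma center_convex x y z : center W x -> center W y -> heq W x y ->
  cle x z -> cle z y -> center W z /\ heq W z x.
Proof.
move=> cx cy xy xz zy.
have zx : heq W z x.
  split; last exact: cle_hle.
  by apply: (hle_trans axW) (cle_hle axW zy) _; case: xy.
split=> // a az; have ax := heq_trans axW az zx; split.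
  have [[u [ua ux]] _] := cx a ax.
  by exists u; split=> //; apply: cle_trans xz.
have [_ [v [av yv]]] := cy a (heq_trans axW ax xy).
by exists v; split=> //; apply: cle_trans yv.
Qed.

(** Lower witnesses come from [x]. For an upper one, move [a] up to some [v] above [x], then [v] up
    to some [w] above [y]. *)
Lemma center_join x y : center W x -> center W y -> heq W x y ->
  center W (join x y) /\ heq W (join x y) x.
Proof.
move=> cx cy xy; have [xj yj jU] := joinP x y.
have jx : heq W (join x y) x.
  have [_ [v [/(weqE axW)[xv vx] yv]]] := cy x xy.
  split; last exact: cle_hle.
  by apply: hle_trans vx => //; apply: cle_hle => //; apply: jU.
split=> // a aj; have ax := heq_trans axW aj jx; split.
  have [[u [ua ux]] _] := cx a ax.
  by exists u; split=> //; apply: cle_trans xj.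
have [_ [v [/(weqE axW)[av va] xv]]] := cx a ax.
have va' : heq W v a by split=> //; apply: cle_hle.
have vy := heq_trans axW va' (heq_trans axW ax xy).
have [_ [w [/(weqE axW)[vw wv] yw]]] := cy v vy.
exists w; split; last by apply: jU => //; apply: cle_trans vw.
apply/(weqE axW); split; first exact: cle_trans vw.
exact: hle_trans va.
Qed.

Lemma center_meet x y : center W x -> center W y -> heq W x y ->
  center W (meet x y) /\ heq W (meet x y) x.
Proof.
move=> cx cy xy; have [mx my mU] := meetP x y.
have m_x : heq W (meet x y) x.
  have [[v [/(weqE axW)[vx xv] vy]] _] := cy x xy.
  split; first exact: cle_hle.
  by apply: hle_trans xv _ => //; apply: cle_hle => //; apply: mU.
split=> // a am; have ax := heq_trans axW am m_x; split; last first.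
  have [_ [u [ua xu]]] := cx a ax.
  by exists u; split=> //; apply: cle_trans xu.
have [[v [/(weqE axW)[va av] vx]] _] := cx a ax.
have va' : heq W v a by split=> //; apply: cle_hle.
have vy := heq_trans axW va' (heq_trans axW ax xy).
have [[w [/(weqE axW)[wv vw] wy]] _] := cy v vy.
exists w; split; last by apply: mU => //; apply: cle_trans vx.
apply/(weqE axW); split; first exact: cle_trans va.
exact: hle_trans vw.
Qed.

(* [join x y] is a center because it lies between [y] and [join y y1], where
   [y1] is a center above [x] in the class of [y]. *)
Lemma tame_center_join x y : tame_center W x -> tame_center W y -> hle W x y ->
  tame_center W (join x y) /\ heq W (join x y) y.
Proof.
move=> [cx tx] [cy ty] xy; have [xj yj jU] := joinP x y.
have [y1 [y1y cy1 xy1]] := (tx y).1 xy.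
have [cj1 j1y] := center_join cy cy1 (heq_sym y1y).
have [cj jy] : center W (join x y) /\ heq W (join x y) y.
  have [yj1 y1j1 _] := joinP y y1.
  apply: (center_convex cy cj1 (heq_sym j1y) yj).
  by apply: jU => //; apply: cle_trans y1j1.
split=> //; split=> // a; split=> ja.
  have ya : hle W y a by apply: hle_trans ja => //; case: jy.
  have [t1 [t1a ct1 xt1]] := (tx a).1 (hle_trans axW xy ya).
  have [t2 [t2a ct2 yt2]] := (ty a).1 ya.
  have [ct tt1] := center_join ct1 ct2 (heq_trans axW t1a (heq_sym t2a)).
  have [t1t t2t _] := joinP t1 t2.
  exists (join t1 t2); split=> //; first exact: heq_trans t1a.
  by apply: jU; [apply: cle_trans t1t|apply: cle_trans t2t].
have [|t [ta ct t_le]] := (ty a).2.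
  by apply: hle_trans ja _ => //; case: jy.
by exists t; split=> //; apply: cle_trans yj.
Qed.

(** Dually to [tame_center_join], [meet x y] lies between [meet y y1] and [y], with [y1] a center
    below [x] in the class of [y]. *)
Lemma tame_center_meet x y : tame_center W x -> tame_center W y -> hle W y x ->
  tame_center W (meet x y) /\ heq W (meet x y) y.
Proof.
move=> [cx tx] [cy ty] yx; have [mx my mU] := meetP x y.
have [y1 [y1y cy1 y1x]] := (tx y).2 yx.
have [cm1 m1y] := center_meet cy cy1 (heq_sym y1y).
have [m1_le_y m1y1 _] := meetP y y1.
have [cm mm1] : center W (meet x y) /\ heq W (meet x y) (meet y y1).
  apply: (center_convex cm1 cy m1y _ my).
  by apply: mU => //; apply: cle_trans y1x.
have m_y := heq_trans axW mm1 m1y.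
split=> //; split=> // a; split=> ma; last first.
  have ay : hle W a y by apply: hle_trans ma _ => //; case: m_y.
  have [t1 [t1a ct1 t1x]] := (tx a).2 (hle_trans axW ay yx).
  have [t2 [t2a ct2 t2y]] := (ty a).2 ay.
  have [ct tt1] := center_meet ct1 ct2 (heq_trans axW t1a (heq_sym t2a)).
  have [tt1' tt2 _] := meetP t1 t2.
  exists (meet t1 t2); split=> //; first exact: heq_trans t1a.
  by apply: mU; [apply: cle_trans t1x|apply: cle_trans t2y].
have [|t [ta ct yt]] := (ty a).1.
  by apply: hle_trans ma => //; case: m_y.
by exists t; split=> //; apply: cle_trans yt.
Qed.

Lemma tame_center_above (h : seq C) d :
  (forall p, In p h -> tame_center W p) -> tame_center W d ->
  exists e, [/\ tame_center W e, heq W e d &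
                forall p, In p h -> hle W p d -> cle p e].
Proof.
move=> + td; elim: h => [|p h IH] th.
  by exists d; split=> //; apply: heq_refl.
have [|e [te ed he]] := IH; first by move=> q qh; apply: th; right.
have [pd|pd] := pselect (hle W p d); last first.
  by exists e; split=> // q [<-|]; [|apply: he].
have [pj ej _] := joinP p e.
have [||tj je] := tame_center_join (th p _) te _; first by left.
  by apply: hle_trans pd _ => //; case: ed.
exists (join p e); split=> // [|q [<-//|qh qd]]; first exact: heq_trans ed.
by apply: cle_trans ej; apply: he.
Qed.

(** The last clause ensures that lower bounds secured by [tame_center_above] survive the meets taken
    here. *)
Lemma tame_center_below (h : seq C) d :
  (forall p, In p h -> tame_center W p) -> tame_center W d ->
  exists e, [/\ tame_center W e, heq W e d,
                forall p, In p h -> hle W d p -> cle e p &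
                forall q, cle q d ->
                  (forall p, In p h -> hle W d p -> cle q p) -> cle q e].
Proof.
move=> + td; elim: h => [|p h IH] th.
  by exists d; split=> //; apply: heq_refl.
have [|e [te ed he qe]] := IH; first by move=> q qh; apply: th; right.
have [dp|dp] := pselect (hle W d p); last first.
  exists e; split=> // [q [<-|]|q qd hq]; [by []|exact: he|].
  by apply: qe => // r rh; apply: hq; right.
have [mp me mU] := meetP p e.
have [||tm m_e] := tame_center_meet (th p _) te _; first by left.
  by apply: hle_trans dp => //; case: ed.
exists (meet p e); split=> // [|q [<-//|qh dq]|q qd hq].
- exact: heq_trans ed.
- by apply: cle_trans me _; apply: he.
- by apply: mU; [apply: hq dp; left|apply: qe => // r rh; apply: hq; right].
Qed.

Definition monotone_centers (h : seq C) : Prop :=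
  (forall p, In p h -> tame_center W p) /\
  (forall p q, In p h -> In q h -> hle W p q -> cle p q).

Lemma monotone_centers_extend (h : seq C) a : monotone_centers h ->
  exists e, heq W e a /\ monotone_centers (e :: h).
Proof.
move=> [th mh]; have [d [da td]] : exists d, heq W d a /\ tame_center W d.
  by case: axW.
have [e1 [te1 e1d he1]] := tame_center_above th td.
have [e [te ee1 he qe]] := tame_center_below th te1.
have ed := heq_trans axW ee1 e1d.
exists e; split; first exact: heq_trans da.
split=> [p [<-//|]|p q]; first exact: th.
case=> [<-|ph] [<-|qh] pq; first exact: cle_refl; last exact: mh.
  by apply: he => //; apply: hle_trans pq => //; case: ee1.
(* A lower [p] is below [e1] by the joins, and below each upper [r] because [h] is already
   monotone. *)
apply: qe => [|r rh e1r].
  by apply: he1 => //; apply: hle_trans pq _ => //; case: ed.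
apply: mh => //; apply: hle_trans e1r => //.
by apply: hle_trans pq _ => //; case: ee1.
Qed.

(** Recursion on the list of earlier choices. The sequence [r] may meet a class repeatedly:
    monotonicity then makes the chosen centers mutually comparable. *)
Lemma countable_center_choice (r : nat -> C) : exists c : nat -> C,
  [/\ forall n, heq W (c n) (r n), forall n, center W (c n) &
      forall m n, hle W (c m) (c n) -> cle (c m) (c n)].
Proof.
(* The extension is made total, with default [ha.2] on lists that are not monotone; [hist] never
   produces one. *)
have extP (ha : seq C * C) : exists e, monotone_centers ha.1 ->
    heq W e ha.2 /\ monotone_centers (e :: ha.1).
  have [mh|nh] := pselect (monotone_centers ha.1).
    by have [e ?] := @monotone_centers_extend _ ha.2 mh; exists e.
  by exists ha.2.
have [ext {}extP] := choice extP.
pose fix hist n := if n is m.+1 then ext (hist m, r m) :: hist m else [::].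
pose c n := ext (hist n, r n).
have hist_mono n : monotone_centers (hist n).
  by elim: n => [|n /(extP (hist n, r n))[]]; [split|].
have c_hist m n : m < n -> In (c m) (hist n).
  elim: n => // n IH; rewrite ltnS leq_eqVlt => /orP[/eqP->|/IH]; first by left.
  by right.
exists c; split=> [n|n|m n].
- by have [] := extP (hist n, r n) (hist_mono n).
- by have [th _] := hist_mono n.+1; case: (th _ (c_hist n n.+1 (leqnn _))).
(* Stage [(maxn m n).+1] is late enough for both values to be in the history. *)
- have [_] := hist_mono (maxn m n).+1; apply; apply: c_hist.
    by rewrite ltnS leq_maxl.
  by rewrite ltnS leq_maxr.
Qed.

(** Each component lies in a single [heq] class, so countability of the components passes to these
    classes. *)
Lemma zigzag_heq a b : zigzag W a b -> heq W a b.
Proof.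
elim=> {a b} [a b ab|a|a b _|a b c _ ab _]; last exact: heq_trans.
- by have /(weqE axW)[? ?] := ab; split=> //; apply: cle_hle.
- exact: heq_refl.
- exact: heq_sym.
Qed.

Lemma countable_representatives (z : C) : countable (components W) ->
  exists r : nat -> C, forall a, exists n, heq W (r n) a.
Proof.
move=> /countable_injP[f f_inj].
pose cls a := [set y | zigzag W a y].
(* [r] is any object whose component has code [n], or the default [z] if there is none. *)
have rP n : exists r, forall a, f (cls a) = n -> heq W r a.
  have [[r rn]|nr] := pselect (exists r, f (cls r) = n); last first.
    by exists z => a an; case: nr; exists a.
  exists r => a an; have clsP b : cls b \in components W.
    rewrite inE; exists b => //.
    by have [g Wg] := weq_refl axW b; apply: smor_src Wg.
  apply: zigzag_heq; rewrite -[zigzag W r a]/(cls r a).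
  have -> : cls r = cls a by apply: f_inj => //; rewrite rn.
  exact: rst_refl.
by have [r {}rP] := choice rP; exists r => a; exists (f (cls a)); apply: rP.
Qed.

Lemma center_axioms_choice (z : C) : countable (components W) ->
  exists chi : C -> C,
    [/\ forall a, heq W (chi a) a, forall a, center W (chi a) &
        forall a b, hle W a b -> cle (chi a) (chi b)].
Proof.
move=> /(countable_representatives z)[r /choice[n rP]].
have [c [cr cc cm]] := countable_center_choice r.
have ca a : heq W (c (n a)) a by apply: heq_trans (rP a).
exists (fun a => c (n a)); split=> // a b ab; apply: cm.
have [[? _] [_ ?]] := (ca a, ca b).
by apply: (@hle_trans _ _ axW a) => //; apply: hle_trans ab _.
Qed.

End Choice.

Theorem theorem3 :
  exists T : set sentence,
    forall (C : category) (W : subcategory C),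
      is_poset C -> finitely_bicomplete C -> countable (components W) ->
      ((forall s : sentence, T s -> models W s) <->
       exists cof fib : subcategory C, is_model_structure W cof fib).
Proof.
exists [set Fcenter_axioms] => C W posetC bicompleteC countableW; split.
  move=> /(_ _ erefl)/models_center_axioms axW.
  have [meet meetP] := exists_meet_op posetC bicompleteC.
  have [join joinP] := exists_join_op posetC bicompleteC.
  (* Any object would serve as this default value. *)
  have [z _] := exists_top posetC bicompleteC.
  have [chi [chi_heq chi_center chi_mono]] :=
    center_axioms_choice axW meetP joinP z countableW.
  by do 2!eexists; apply: (center_model_structure posetC axW meetP joinP).
move=> [cof [fib modelW]] s ->; apply/models_center_axioms.
exact: model_center_axioms modelW.
Qed.
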